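(* Let $R$ be a $\phi$-ring. Then $R$ is nonnil-coherent if and only if the class of $\phi$-flat $R$-modules is preenveloping.
   Context: All rings are commutative with identity and all modules are unitary. $\mathrm{Nil}(R)$ denotes the set of nilpotent elements of $R$. $R$ is a $\phi$-ring if $\mathrm{Nil}(R)$ is a divided prime ideal, i.e. $\mathrm{Nil}(R)$ is a prime ideal and $\mathrm{Nil}(R)\subsetneq (x)$ for every $x\in R\setminus \mathrm{Nil}(R)$. An ideal of $R$ is nonnil if it contains a non-nilpotent element. A $\phi$-ring is nonnil-coherent if each of its finitely generated nonnil ideals is finitely presented. An $R$-module $T$ is $\phi$-torsion if for every $x\in T$ there is a nonnil ideal $I$ of $R$ with $Ix=0$. An $R$-module $M$ is $\phi$-flat if $\operatorname{Tor}_1^R(T,M)=0$ for every $\phi$-torsion $R$-module $T$. For a class $\mathcal{F}$ of $R$-modules, an $\mathcal{F}$-preenvelope of an $R$-module $M$ is a homomorphism $f:M\to F$ with $F\in\mathcal{F}$ such that every homomorphism $f':M\to F'$ with $F'\in\mathcal{F}$ factors as $f'=g\circ f$ for some $g:F\to F'$. The class $\mathcal{F}$ is preenveloping if every $R$-module has an $\mathcal{F}$-preenvelope. *)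

(* Defs.v *)
From HB Require Import structures.
From mathcomp Require Import all_boot all_algebra.
From mathcomp Require Import boolp.
From mathcomp.multinomials Require Import freeg.

Set Implicit Arguments.
Unset Strict Implicit.
Unset Printing Implicit Defensive.

Import GRing.Theory.
Local Open Scope ring_scope.
Local Open Scope quotient_scope.

(* The library's [submodClosed V] is the type of boolean predicates on [V]
   that contain 0 and are stable under linear combinations; since [boolp]
   turns every proposition into a boolean, these are all the submodules.  The
   ideals of [R], the improper one included, are the submodules of [R^o]. *)

Section Submodule.
Variables (R : comNzRingType) (V : lmodType R) (W : submodClosed V).

Record submod := Submod { submod_val : V; submod_valP : submod_val \in W }.

HB.instance Definition _ := [isSub for submod_val].
HB.instance Definition _ := [Choice of submod by <:].
HB.instance Definition _ := [SubChoice_isSubLmodule of submod by <:].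

End Submodule.

Section QuotientModule.
Variables (R : comNzRingType) (V : lmodType R) (W : submodClosed V).

Definition quotmod_pred : {pred V} := [pred x | x \in W].

Fact quotmod_pred_zmod : zmod_closed quotmod_pred.
Proof.
have [W0 WB] := GRing.submod_closedB (GRing.submodClosedP W).
by split=> [|x y]; rewrite !inE //; apply: WB.
Qed.

HB.instance Definition _ :=
  GRing.isZmodClosed.Build V quotmod_pred quotmod_pred_zmod.

Definition quotmod := Quotient.quot quotmod_pred.

HB.instance Definition _ := GRing.Zmodule.on quotmod.
HB.instance Definition _ := Quotient.on quotmod.

Definition quotmod_proj (x : V) : quotmod := \pi_quotmod x.

Lemma quotmod_projB : zmod_morphism quotmod_proj.
Proof. by move=> x y; rewrite /quotmod_proj raddfB. Qed.

HB.instance Definition _ :=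
  GRing.isZmodMorphism.Build V quotmod quotmod_proj quotmod_projB.

Lemma quotmod_proj_eq0 x : (quotmod_proj x == 0) = (x \in W).
Proof.
have -> : 0 = quotmod_proj 0 by rewrite raddf0.
by rewrite /quotmod_proj -Quotient.idealrBE subr0.
Qed.

Lemma quotmod_reprK : cancel repr quotmod_proj.
Proof. exact: reprK. Qed.

Definition quotmod_scale (a : R) (q : quotmod) := quotmod_proj (a *: repr q).

Lemma quotmod_scale_proj a x :
  quotmod_scale a (quotmod_proj x) = quotmod_proj (a *: x).
Proof.
apply/eqP; rewrite -subr_eq0 -raddfB quotmod_proj_eq0 -scalerBr rpredZ //.
by rewrite -quotmod_proj_eq0 raddfB /= quotmod_reprK subrr.
Qed.

Fact quotmod_scaleA a b q :
  quotmod_scale a (quotmod_scale b q) = quotmod_scale (a * b) q.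
Proof. by rewrite -[q]quotmod_reprK !quotmod_scale_proj scalerA. Qed.

Fact quotmod_scale1 : left_id 1 quotmod_scale.
Proof. by move=> q; rewrite -[q]quotmod_reprK quotmod_scale_proj scale1r. Qed.

Fact quotmod_scaleDr : right_distributive quotmod_scale +%R.
Proof.
move=> a q r; rewrite -[q]quotmod_reprK -[r]quotmod_reprK -raddfD.
by rewrite !quotmod_scale_proj scalerDr raddfD.
Qed.

Fact quotmod_scaleDl q : {morph quotmod_scale^~ q : a b / a + b}.
Proof.
move=> a b; rewrite -[q]quotmod_reprK !quotmod_scale_proj.
by rewrite scalerDl raddfD.
Qed.

HB.instance Definition _ := GRing.Zmodule_isLmodule.Build R quotmod
  quotmod_scaleA quotmod_scale1 quotmod_scaleDr quotmod_scaleDl.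

Lemma quotmod_projZ : scalable quotmod_proj.
Proof. by move=> a x; rewrite -quotmod_scale_proj. Qed.

HB.instance Definition _ :=
  GRing.isScalable.Build R V quotmod *:%R quotmod_proj quotmod_projZ.

End QuotientModule.

Section Kernel.
Variables (R : comNzRingType) (U V : lmodType R) (f : {linear U -> V}).

Definition ker : {pred U} := [pred x | f x == 0].

Fact ker_submod : submod_closed ker.
Proof.
split=> [|a x y]; rewrite !inE ?raddf0 // => /eqP fx /eqP fy.
by rewrite linearP fx fy scaler0 addr0.
Qed.

HB.instance Definition _ := GRing.isSubmodClosed.Build R U ker ker_submod.

End Kernel.

(* The homology ker g / (im f :&: ker g) of U -f-> V -g-> W; in a complex
   im f is contained in ker g and this is the usual ker g / im f. *)
Section Homology.
Variables (R : comNzRingType) (U V W : lmodType R).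
Variables (f : {linear U -> V}) (g : {linear V -> W}).

Definition boundary : {pred submod (ker g)} :=
  [pred z | `[< exists x, f x = val z >]].

Fact boundary_submod : submod_closed boundary.
Proof.
split=> [|a z t]; rewrite !inE.
  by apply/asboolP; exists 0; rewrite !raddf0.
move=> /asboolP[x fx] /asboolP[y fy]; apply/asboolP; exists (a *: x + y).
by rewrite linearP fx fy linearP.
Qed.

HB.instance Definition _ :=
  GRing.isSubmodClosed.Build R (submod (ker g)) boundary boundary_submod.

Definition homology := quotmod boundary.

HB.instance Definition _ := GRing.Lmodule.on homology.

End Homology.

Section FreeModule.
Variables (R : comNzRingType) (X : choiceType) (V : lmodType R) (f : X -> V).

Fact fglift_zmod_morphism : zmod_morphism (fglift f).
Proof. exact: lift_is_additive. Qed.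

HB.instance Definition _ :=
  GRing.isZmodMorphism.Build {freeg X / R} V (fglift f) fglift_zmod_morphism.

Fact fglift_scalable : scalable (fglift f).
Proof.
move=> a D; rewrite -[in RHS](freeg_sumE D).
rewrite -[a *: D]/(\sum_(x <- dom D) << a * coeff x D *g x >>).
rewrite !raddf_sum; apply: eq_bigr => x _ /=.
by rewrite !liftU scalerA.
Qed.

HB.instance Definition _ := GRing.isScalable.Build
  R {freeg X / R} V *:%R (fglift f) fglift_scalable.

End FreeModule.

Section Tensor.
Variables (R : comNzRingType) (M N : lmodType R).

Let F := {freeg (M * N) / R}.

Inductive tensor_relator : F -> Prop :=
| TensorAddl x x' y :
    tensor_relator (<< (x + x', y) >> - << (x, y) >> - << (x', y) >>)
| TensorAddr x y y' :
    tensor_relator (<< (x, y + y') >> - << (x, y) >> - << (x, y') >>)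
| TensorScalel a x y :
    tensor_relator (<< (a *: x, y) >> - a *: << (x, y) >>)
| TensorScaler a x y :
    tensor_relator (<< (x, a *: y) >> - a *: << (x, y) >>).

Definition tensor_relation : {pred F} := [pred z |
  `[< forall S : submodClosed F,
        (forall r, tensor_relator r -> r \in S) -> z \in S >]].

Fact tensor_relation_submod : submod_closed tensor_relation.
Proof.
split=> [|a x y]; rewrite !inE.
  by apply/asboolP => S _; exact: rpred0.
move=> /asboolP hx /asboolP hy; apply/asboolP => S hS.
by rewrite rpredD ?rpredZ ?hx ?hy.
Qed.

HB.instance Definition _ :=
  GRing.isSubmodClosed.Build R F tensor_relation tensor_relation_submod.

Definition tensor := quotmod tensor_relation.

HB.instance Definition _ := GRing.Lmodule.on tensor.

Definition tens (x : M) (y : N) : tensor := quotmod_proj _ << (x, y) >>.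

Lemma tensor_relator_eq0 r :
  tensor_relator r -> quotmod_proj tensor_relation r = 0.
Proof.
by move=> hr; apply/eqP; rewrite quotmod_proj_eq0 inE; apply/asboolP => S; apply.
Qed.

Lemma tensDl x x' y : tens (x + x') y = tens x y + tens x' y.
Proof.
apply/eqP; rewrite -subr_eq0 opprD addrA -!raddfB.
exact/eqP/tensor_relator_eq0/TensorAddl.
Qed.

Lemma tensDr x y y' : tens x (y + y') = tens x y + tens x y'.
Proof.
apply/eqP; rewrite -subr_eq0 opprD addrA -!raddfB.
exact/eqP/tensor_relator_eq0/TensorAddr.
Qed.

Lemma tensZl a x y : tens (a *: x) y = a *: tens x y.
Proof.
apply/eqP; rewrite -subr_eq0 -linearZ -raddfB.
exact/eqP/tensor_relator_eq0/TensorScalel.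
Qed.

Lemma tensZr a x y : tens x (a *: y) = a *: tens x y.
Proof.
apply/eqP; rewrite -subr_eq0 -linearZ -raddfB.
exact/eqP/tensor_relator_eq0/TensorScaler.
Qed.

End Tensor.

Arguments tensor_relation {R} M N.

Section TensorMap.
Variables (R : comNzRingType) (M M' N : lmodType R) (f : {linear M -> M'}).

Local Notation lift :=
  (fglift (fun p : M * N => tens (f p.1) p.2) : {freeg (M * N) / R} -> _).

Definition tensor_map (t : tensor M N) : tensor M' N := lift (repr t).

Fact tensor_lift_eq0 z : z \in tensor_relation M N -> lift z = 0.
Proof.
rewrite inE => /asboolP /(_ (ker lift)) /[!inE] h; apply/eqP/h => r.
case=> [x x' y|x y y'|a x y|a x y];
  rewrite inE !raddfB /= !liftU !scale1r /=.
- by rewrite raddfD tensDl -addrA -opprD subrr.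
- by rewrite tensDr -addrA -opprD subrr.
- by rewrite linearZ /= tensZl linearZ_LR /= liftU scale1r subrr.
- by rewrite tensZr linearZ_LR /= liftU scale1r subrr.
Qed.

Fact tensor_map_proj D : tensor_map (quotmod_proj _ D) = lift D.
Proof.
apply/eqP; rewrite -subr_eq0 -raddfB /= tensor_lift_eq0 //.
have: quotmod_proj (tensor_relation M N)
        (repr (quotmod_proj (tensor_relation M N) D) - D) == 0.
  by rewrite raddfB /= quotmod_reprK subrr.
by rewrite quotmod_proj_eq0.
Qed.

Lemma tensor_map_tens x y : tensor_map (tens x y) = tens (f x) y.
Proof. by rewrite tensor_map_proj liftU scale1r. Qed.

Fact tensor_map_linear : linear tensor_map.
Proof.
move=> a t u; rewrite -[t]quotmod_reprK -[u]quotmod_reprK.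
by rewrite -linearP !tensor_map_proj linearP.
Qed.

HB.instance Definition _ := GRing.isLinear.Build
  R (tensor M N) (tensor M' N) *:%R tensor_map tensor_map_linear.

End TensorMap.

Arguments tensor_map {R M M'} N f.

(* The canonical free resolution ... -> F_2 -> F_1 -> F_0 -> T -> 0, where
   each F_i is free on the underlying set of the previous kernel. *)
Section Tor1.
Variables (R : comNzRingType) (T M : lmodType R).

Definition free_cover (U : lmodType R) : {freeg U / R} -> U := fglift id.

HB.instance Definition _ U := GRing.Linear.on (@free_cover U).

Definition syzygy (U : lmodType R) : lmodType R := submod (ker (@free_cover U)).

Definition free_diff (U : lmodType R) :
    {freeg (syzygy U) / R} -> {freeg U / R} :=
  val \o @free_cover (syzygy U).

HB.instance Definition _ U := GRing.Linear.on (@free_diff U).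

Definition Tor1 : lmodType R :=
  homology (tensor_map M (@free_diff (syzygy T))) (tensor_map M (@free_diff T)).

End Tor1.

Section PhiRings.
Variable R : comNzRingType.

Definition nilradical : {pred R} := [pred x | `[< exists n, x ^+ n = 0 >]].

Definition principal (x : R) : {pred R} :=
  [pred y | `[< exists a, y = a * x >]].

(* [idealr_closed] includes 1 \notin nilradical. *)
Definition phi_ring : Prop :=
  [/\ idealr_closed nilradical, prime_idealr_closed nilradical &
    forall x, x \notin nilradical ->
      {subset nilradical <= principal x} /\
      ~ {subset principal x <= nilradical}].

Definition nonnil (I : submodClosed R^o) : Prop :=
  exists2 x, x \in I & x \notin nilradical.

Definition finitely_generated (M : lmodType R) : Prop :=
  exists n (f : {linear 'rV[R]_n -> M}), forall x, exists v, f v = x.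

Definition finitely_presented (M : lmodType R) : Prop :=
  exists m n (g : {linear 'rV[R]_m -> 'rV[R]_n}) (f : {linear 'rV[R]_n -> M}),
    (forall x, exists v, f v = x) /\
    (forall v, f v = 0 <-> exists w, g w = v).

Definition nonnil_coherent : Prop :=
  forall I : submodClosed R^o, nonnil I ->
    finitely_generated (submod I) -> finitely_presented (submod I).

Definition phi_torsion (T : lmodType R) : Prop :=
  forall x : T, exists2 I : submodClosed R^o,
    nonnil I & forall a, a \in I -> (a : R) *: x = 0.

Definition phi_flat (M : lmodType R) : Prop :=
  forall T : lmodType R, phi_torsion T -> forall z : Tor1 T M, z = 0.

Definition preenvelope (F : lmodType R -> Prop) (M E : lmodType R)
    (f : {linear M -> E}) : Prop :=
  F E /\ forall (E' : lmodType R) (f' : {linear M -> E'}), F E' ->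
    exists g : {linear E -> E'}, f' =1 g \o f.

Definition preenveloping (F : lmodType R -> Prop) : Prop :=
  forall M : lmodType R, exists (E : lmodType R) (f : {linear M -> E}),
    preenvelope F f.

End PhiRings.

(* Main.v *)
(* Phi-flatness is equivalent to an equational criterion (nonnil_flat below):
   whenever a.m = 0 for a column a generating a nonnil ideal, m is an M-linear
   combination of syzygies of a.  This criterion passes to retracts and to pure
   submodules, and over a nonnil-coherent ring also to products, since one
   finite family of syzygies of a serves all the factors at once.  Hence the
   product of all phi-flat quotients of one fixed free module under M, large
   enough to cover the pure closure of the image of M in any module, is a
   preenvelope of M.  Conversely, if phi-flat modules are preenveloping, a power
   of R is a retract of its preenvelope, hence phi-flat; the criterion applied
   to the tautological family of all syzygies of a, in the power of R that they
   index, says that finitely many of them generate the others. *)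

From HB Require Import structures.
Require Import Defs.
From mathcomp Require Import all_boot all_algebra.
From mathcomp Require Import boolp.
From mathcomp.multinomials Require Import freeg.

Set Implicit Arguments.
Unset Strict Implicit.
Unset Printing Implicit Defensive.

Import GRing.Theory.
Local Open Scope ring_scope.

(** * Linear maps, submodules and free modules *)

Lemma exists_linear (R : comNzRingType) (U V : lmodType R) (h : U -> V) :
  linear h -> exists g : {linear U -> V}, g =1 h.
Proof.
move=> hP; pose H := GRing.isLinear.Build R U V *:%R h hP.
by exists (HB.pack h H : {linear U -> V}).
Qed.

Lemma exists_submod (R : comNzRingType) (V : lmodType R) (P : V -> Prop) :
    P 0 -> (forall a x y, P x -> P y -> P (a *: x + y)) ->
  exists S : submodClosed V, forall x, x \in S <-> P x.
Proof.
move=> P0 PD; pose Q : {pred V} := [pred x | `[< P x >]].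
have QP : submod_closed Q.
  split=> [|a x y]; rewrite !inE; first exact/asboolP.
  by move=> /asboolP Px /asboolP Py; exact/asboolP/PD.
pose H := GRing.isSubmodClosed.Build R V Q QP.
by exists (HB.pack Q H : submodClosed V) => x; split=> /asboolP.
Qed.

Lemma freeg_scaleU (R : comNzRingType) (X : choiceType) (c : R) (x : X) :
  << c *g x >> = c *: << x >>.
Proof. by apply/eqP/freeg_eqP => y; rewrite coeffZ !coeffU mul1r. Qed.

Lemma eq_freeg_linear (R : comNzRingType) (X : choiceType) (V : lmodType R)
    (f g : {freeg X / R} -> V) :
  linear f -> linear g -> (forall x, f << x >> = g << x >>) ->
  forall u, f u = g u.
Proof.
move=> /exists_linear[f' fE] /exists_linear[g' gE] fg u; rewrite -fE -gE.
rewrite -[u]freeg_sumE !raddf_sum /=; apply: eq_bigr => x _.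
by rewrite freeg_scaleU !linearZ_LR /= fE gE fg.
Qed.

(** * Induction on tensors and the universal property *)

Section TensorProduct.
Variables (R : comNzRingType) (U V : lmodType R).

(** Scalars need no case of their own: they are absorbed by the left factor of a pure tensor. *)
Lemma tensor_ind (P : tensor U V -> Prop) :
    P 0 -> (forall t u, P t -> P u -> P (t + u)) ->
    (forall x y, P (tens x y)) ->
  forall t, P t.
Proof.
move=> P0 PD Pt t; rewrite -[t]quotmod_reprK -(freeg_sumE (repr t)) raddf_sum.
apply: big_ind => // -[x y] _.
by rewrite freeg_scaleU /= linearZ_LR /= -/(tens x y) -tensZl.
Qed.

Lemma tensor_lift (W : lmodType R) (b : U -> V -> W) :
    (forall y, linear (b^~ y)) -> (forall x, linear (b x)) ->
  exists h : {linear tensor U V -> W}, forall x y, h (tens x y) = b x y.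
Proof.
move=> bl br; pose lift : {linear {freeg (U * V) / R} -> W} :=
  fglift (fun p : U * V => b p.1 p.2).
have lift0 z : z \in tensor_relation U V -> lift z = 0.
  rewrite inE => /asboolP /(_ (ker lift)) /[!inE] h; apply/eqP/h => r.
  case=> [x x' y|x y y'|a x y|a x y]; rewrite inE !raddfB /= !liftU !scale1r /=.
  - by rewrite -[x]scale1r bl !scale1r -addrA -opprD subrr.
  - by rewrite -[y]scale1r br !scale1r -addrA -opprD subrr.
  - rewrite linearZ_LR /= liftU scale1r /=.
    have b0 : b 0 y = 0.
      by have := bl y (-1) 0 0; rewrite scaler0 addr0 scaleN1r addNr.
    by rewrite -[a *: x]addr0 bl b0 addr0 subrr.
  - rewrite linearZ_LR /= liftU scale1r /=.
    have b0 : b x 0 = 0.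
      by have := br x (-1) 0 0; rewrite scaler0 addr0 scaleN1r addNr.
    by rewrite -[a *: y]addr0 br b0 addr0 subrr.
pose h (t : tensor U V) := lift (repr t).
have hE D : h (quotmod_proj _ D) = lift D.
  apply/eqP; rewrite -subr_eq0 -raddfB /= lift0 //.
  have: quotmod_proj (tensor_relation U V)
          (repr (quotmod_proj (tensor_relation U V) D) - D) == 0.
    by rewrite raddfB /= quotmod_reprK subrr.
  by rewrite quotmod_proj_eq0.
have [|g gE] := @exists_linear R (tensor U V) W h.
  move=> a t u; rewrite -[t]quotmod_reprK -[u]quotmod_reprK.
  by rewrite -linearP !hE linearP.
by exists g => x y; rewrite gE hE /lift /= liftU scale1r.
Qed.

Lemma tens0r (x : U) : tens x (0 : V) = 0.
Proof. by rewrite -[0 in LHS](scale0r 0) tensZr scale0r. Qed.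

Lemma tens_suml (I : Type) (r : seq I) (c : I -> U) (y : V) :
  tens (\sum_(i <- r) c i) y = \sum_(i <- r) tens (c i) y.
Proof.
elim/big_rec2: _ => [|i _ u _ <-]; last by rewrite tensDl.
by rewrite -[0 in LHS](scale0r 0) tensZl scale0r.
Qed.

Lemma tens_sumr (I : Type) (r : seq I) (x : U) (c : I -> V) :
  tens x (\sum_(i <- r) c i) = \sum_(i <- r) tens x (c i).
Proof. by elim/big_rec2: _ => [|i _ u _ <-]; rewrite (tens0r, tensDr). Qed.

End TensorProduct.

(** * Products of modules *)

Section ProductModule.
Variables (R : comNzRingType) (I : Type) (V : I -> lmodType R).

Definition prodmod := forall i, V i.

HB.instance Definition _ := Choice.on prodmod.

Implicit Types f g : prodmod.

Definition prodmod_add f g : prodmod := fun i => f i + g i.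

Definition prodmod_opp f : prodmod := fun i => - f i.

Fact prodmod_addA : associative prodmod_add.
Proof. by move=> f g h; apply/functional_extensionality_dep => i; exact: addrA. Qed.

Fact prodmod_addC : commutative prodmod_add.
Proof. by move=> f g; apply/functional_extensionality_dep => i; exact: addrC. Qed.

Fact prodmod_add0 : left_id (fun=> 0) prodmod_add.
Proof. by move=> f; apply/functional_extensionality_dep => i; exact: add0r. Qed.

Fact prodmod_addN : left_inverse (fun=> 0) prodmod_opp prodmod_add.
Proof. by move=> f; apply/functional_extensionality_dep => i; exact: addNr. Qed.

HB.instance Definition _ := GRing.isZmodule.Build prodmod
  prodmod_addA prodmod_addC prodmod_add0 prodmod_addN.

Definition prodmod_scale (c : R) f : prodmod := fun i => c *: f i.

Fact prodmod_scaleA a b f :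
  prodmod_scale a (prodmod_scale b f) = prodmod_scale (a * b) f.
Proof. by apply/functional_extensionality_dep => i; exact: scalerA. Qed.

Fact prodmod_scale1 : left_id 1 prodmod_scale.
Proof. by move=> f; apply/functional_extensionality_dep => i; exact: scale1r. Qed.

Fact prodmod_scaleDr : right_distributive prodmod_scale +%R.
Proof. by move=> a f g; apply/functional_extensionality_dep => i; exact: scalerDr. Qed.

Fact prodmod_scaleDl f : {morph prodmod_scale^~ f : a b / a + b}.
Proof. by move=> a b; apply/functional_extensionality_dep => i; exact: scalerDl. Qed.

HB.instance Definition _ := GRing.Zmodule_isLmodule.Build R prodmod
  prodmod_scaleA prodmod_scale1 prodmod_scaleDr prodmod_scaleDl.

Lemma prodmod_sumE n (F : 'I_n -> prodmod) i : (\sum_j F j) i = \sum_j F j i.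
Proof. by elim/big_rec2: _ => // j _ f _ <-. Qed.

End ProductModule.

Lemma free_coverU (R : comNzRingType) (U : lmodType R) (x : U) :
  free_cover (<< x >> : {freeg U / R}) = x.
Proof. by rewrite /free_cover liftU scale1r. Qed.

Lemma free_diffU (R : comNzRingType) (U : lmodType R) (x : syzygy U) :
  free_diff (<< x >> : {freeg (syzygy U) / R}) = val x.
Proof. by rewrite /free_diff /= free_coverU. Qed.

(** * Phi-flatness implies the equational criterion *)

Section EquationalFlatness.
Variable R : comNzRingType.

(** Membership of [m] in the image of Syz(a) tensor M in M^n, where Syz(a) is the module of rows
    that kill [a]. *)
Definition from_relations (M : lmodType R) n (a : 'cV[R]_n) (m : 'I_n -> M) :=
  exists k (B : 'M[R]_(k, n)) (y : 'I_k -> M),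
    B *m a = 0 /\ forall i, m i = \sum_j B j i *: y j.

Definition nonnil_column n (a : 'cV[R]_n) :=
  exists c : 'rV_n, (c *m a) 0 0 \notin @nilradical R.

(** Equivalently, the map from I tensor M to M is injective for every finitely generated nonnil
    ideal I. *)
Definition nonnil_flat (M : lmodType R) :=
  forall n (a : 'cV[R]_n) (m : 'I_n -> M), nonnil_column a ->
    \sum_i a i 0 *: m i = 0 -> from_relations a m.

Definition generates n (a : 'cV[R]_n) (I : submodClosed R^o) :=
  forall x : R, x \in I <-> exists c : 'rV_n, x = (c *m a) 0 0.

Lemma generates_exists n (a : 'cV[R]_n) : exists I, generates a I.
Proof.
apply: (@exists_submod R R^o); first by exists 0; rewrite mul0mx mxE.
move=> r _ _ [c ->] [d ->]; exists (r *: c + d).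
by rewrite mulmxDl -scalemxAl !mxE.
Qed.

Lemma nonnil_generates n (a : 'cV[R]_n) I :
  generates a I -> nonnil I <-> nonnil_column a.
Proof.
move=> aI; split=> [[x /aI[c ->] xn]|[c cn]]; first by exists c.
by exists ((c *m a) 0 0) => //; apply/aI; exists c.
Qed.

Variable M : lmodType R.

Lemma from_relations0 n (a : 'cV[R]_n) : from_relations a (fun=> 0 : M).
Proof.
exists 0%N, 0, (fun=> 0); split=> [|i]; first by rewrite mul0mx.
by rewrite big_ord0.
Qed.

(** The two relation matrices are stacked. With the zero and one-row cases this permits induction on
    tensors. *)
Lemma from_relationsD n (a : 'cV[R]_n) (m m' : 'I_n -> M) :
    from_relations a m -> from_relations a m' ->
  from_relations a (fun i => m i + m' i).
Proof.
move=> [k [B [y [Ba mE]]]] [k' [B' [y' [B'a m'E]]]].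
exists (k + k')%N, (col_mx B B'),
  (fun j => match split j with inl i => y i | inr i => y' i end).
split=> [|i]; first by rewrite mul_col_mx Ba B'a col_mx0.
rewrite big_split_ord /= mE m'E; congr (_ + _); apply: eq_bigr => j _.
  by rewrite col_mxEu (unsplitK (inl _ j)).
by rewrite col_mxEd (unsplitK (inr _ j)).
Qed.

Lemma from_relations_row n (a : 'cV[R]_n) (b : 'rV[R]_n) (y : M) :
  b *m a = 0 -> from_relations a (fun i => b 0 i *: y).
Proof.
by move=> ba; exists 1%N, b, (fun=> y); split=> // i; rewrite big_ord1.
Qed.

Lemma syzygyP (T : lmodType R) (k : syzygy T) : free_cover (val k) = 0.
Proof. exact/eqP/(submod_valP k). Qed.

(* Take T = R / (a), with p : R -> T, s a section of p and e = p 1.  The cycle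
   z, the sum of the <<a_i e>> tens m_i, bounds.  Lifting the elements of the
   first syzygy of T along s to rows of coefficients (C below) sends boundaries
   to combinations of syzygies of a, and z to m up to such a combination. *)
Lemma phi_flat_nonnil_flat : phi_flat M -> nonnil_flat M.
Proof.
move=> Mflat n a m an am0.
have [I IE] := generates_exists a.
have [T [p [pI psurj]]] : exists (T : lmodType R) (p : {linear R^o -> T}),
    (forall x, p x = 0 <-> x \in I) /\ (forall t, exists x, p x = t).
  exists (quotmod I), (quotmod_proj I); split=> [x|t].
    by rewrite -quotmod_proj_eq0; split=> /eqP.
  by exists (repr t); exact: quotmod_reprK.
have T_torsion : phi_torsion T.
  move=> t; exists I => [|r rI]; first exact/(nonnil_generates IE).
  have [x <-] := psurj t; rewrite -linearZ_LR; apply/pI.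
  have -> : r *: x = (x : R) *: (r : R^o) by exact: mulrC.
  exact: rpredZ.
pose e : T := p 1.
(* Normalising the section at [e] makes [rho] send a_i <<e>> to a_i exactly, not merely modulo I. *)
have [s [sK sE]] : exists s : T -> R^o, (forall t, p (s t) = t) /\ s e = 1.
  have [s sK] := choice psurj.
  exists (fun t => if t == e then 1 else s t); rewrite eqxx; split=> // t.
  by case: eqP => [->|_].
pose rho : {linear {freeg T / R} -> R^o} := fglift s.
have rho_proj u : p (rho u) = free_cover u.
  apply: (@eq_freeg_linear R T T (fun u => p (rho u))
    (@free_cover R T)) => [r v w|r v w|t].
  - by rewrite !linearP.
  - by rewrite linearP.
  - by rewrite /rho /free_cover /= !liftU !scale1r.
have rhoP (k : syzygy T) : exists c : 'rV_n, rho (val k) = (c *m a) 0 0.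
  by apply/IE/pI; rewrite rho_proj syzygyP.
have [c cE] := choice rhoP.
pose C : {linear {freeg (syzygy T) / R} -> 'rV[R]_n} := fglift c.
(* Hence [C] sends the kernel of [free_cover] to syzygies of [a]. *)
have CE u : (C u *m a) 0 0 = rho (val (free_cover u)).
  apply: (@eq_freeg_linear R (syzygy T) R^o (fun u => (C u *m a) 0 0)
    (fun u => rho (val (free_cover u)))) => [r v w|r v w|k].
  - by rewrite linearP mulmxDl -scalemxAl !mxE.
  - by rewrite !linearP.
  - by rewrite /C /free_cover /= !liftU !scale1r cE.
have [||phi phiE] := @tensor_lift R {freeg (syzygy T) / R} M
  (prodmod (fun _ : 'I_n => M)) (fun u y i => C u 0 i *: y).
- move=> y r u v; apply/functional_extensionality_dep => i.
  rewrite linearP !mxE scalerDl.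
  by rewrite -[RHS]/(r *: (C u 0 i *: y) + C v 0 i *: y) scalerA.
- move=> u r x y; apply/functional_extensionality_dep => i.
  rewrite scalerDr scalerA mulrC.
  by rewrite -[RHS]/(r *: (C u 0 i *: x) + C u 0 i *: y) scalerA.
have phi_boundary x :
    from_relations a (phi (tensor_map M (@free_diff R (syzygy T)) x)).
  elim/tensor_ind: x => [|x y Px Py|w y].
  - by rewrite !linear0; exact: from_relations0.
  - by rewrite !linearD; exact: from_relationsD.
  rewrite tensor_map_tens phiE; apply: from_relations_row.
  apply/matrixP => i j; rewrite !ord1 CE [in RHS]mxE.
  by rewrite /= (syzygyP (free_cover w)) !linear0.
pose g : {freeg T / R} := << e >>.
have gE : free_cover g = e by rewrite /free_cover /= liftU scale1r.
have kP i : a i 0 *: g \in ker (@free_cover R T).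
  rewrite !inE /= linearZ_LR /= gE -linearZ_LR.
  apply/eqP/pI/IE; exists (delta_mx 0 i).
  by rewrite -rowE mxE; exact: mulr1.
pose d i : {freeg (syzygy T) / R} := << Submod (kP i) : syzygy T >>.
have dE i : free_diff (d i) = a i 0 *: g.
  by rewrite /free_diff /free_cover /= liftU scale1r.
pose z := \sum_i tens (d i) (m i).
(* Moving the scalars a_i across, z maps to g tensor the sum of the a_i m_i. *)
have zP : z \in ker (tensor_map M (@free_diff R T)).
  rewrite inE /z raddf_sum /=.
  rewrite (eq_bigr (fun i => tens g (a i 0 *: m i))).
    by rewrite -tens_sumr am0 tens0r.
  by move=> i _; rewrite tensor_map_tens /= dE tensZl tensZr.
have [x xE] : exists x, tensor_map M (@free_diff R (syzygy T)) x = z.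
  have /eqP := Mflat T T_torsion (quotmod_proj _ (Submod zP)).
  by rewrite quotmod_proj_eq0 => /asboolP.
have phiz : phi z = (fun i => \sum_j C (d j) 0 i *: m j) :> prodmod _.
  rewrite /z raddf_sum; apply/functional_extensionality_dep => i.
  by rewrite prodmod_sumE; apply: eq_bigr => j _; rewrite /= phiE.
have Cd j : (C (d j) *m a) 0 0 = a j 0.
  rewrite CE -[val _]/(free_diff (d j)) dE linearZ_LR /= /rho /= liftU scale1r sE.
  exact: mulr1.
(* [Cd] says D a = a, so the rows of 1 - D are syzygies of [a]. Now m splits as D^T m, which is phi
   z, plus (1 - D)^T m. *)
pose D := \matrix_j C (d j).
have Da : (1%:M - D) *m a = 0.
  apply/row_matrixP => j; rewrite row_mul row0 linearB /= rowK mulmxBl.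
  rewrite row1 -rowE; apply/matrixP => i l; rewrite !ord1.
  by rewrite mxE [X in X + _]mxE [X in _ + X]mxE Cd subrr mxE.
have Dm : from_relations a (fun i => \sum_j (1%:M - D) j i *: m j).
  by exists n, (1%:M - D), m.
have := from_relationsD (phi_boundary x) Dm; rewrite xE phiz.
congr from_relations; apply/funext => i; rewrite -big_split /=.
rewrite (bigD1 i) //= big1 => [|j ji]; rewrite !mxE -scalerDl addrCA subrr addr0.
  by rewrite eqxx addr0 mulr1n scale1r.
by rewrite (negPf ji) mulr0n scale0r.
Qed.

End EquationalFlatness.

(** * The equational criterion implies phi-flatness *)

Section EquationalFlatnessConverse.
Variables (R : comNzRingType) (M : lmodType R).

(** Coefficients move into the factor [M]; the [x i] may repeat, since only existence is
    asserted. *)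
Lemma tensor_freegP (X : choiceType) (z : tensor {freeg X / R} M) :
  exists n (x : 'I_n -> X) (m : 'I_n -> M),
    z = \sum_i tens (<< x i >> : {freeg X / R}) (m i).
Proof.
suff [l ->] : exists l : seq (X * M),
    z = \sum_(p <- l) tens (<< p.1 >> : {freeg X / R}) p.2.
  exists (size l), (fun i => (tnth (in_tuple l) i).1),
    (fun i => (tnth (in_tuple l) i).2).
  by rewrite big_tnth.
elim/tensor_ind: z => [|z w [l ->] [l' ->]|u y].
- by exists [::]; rewrite big_nil.
- by exists (l ++ l'); rewrite big_cat.
exists [seq (x, coeff x u *: y) | x <- dom u]; rewrite big_map /=.
rewrite -[u in LHS]freeg_sumE tens_suml.
by apply: eq_bigr => i _; rewrite freeg_scaleU tensZl tensZr.
Qed.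

Variable T : lmodType R.

Let bounds (z : tensor {freeg (syzygy T) / R} M) :=
  exists x, tensor_map M (@free_diff R (syzygy T)) x = z.

Let boundsD z w : bounds z -> bounds w -> bounds (z + w).
Proof. by move=> [x <-] [y <-]; exists (x + y); rewrite linearD. Qed.

(** The cycle [u] names a basis element of the next free module, whose differential is [u]. *)
Let bounds_cycle (u : {freeg (syzygy T) / R}) y :
  free_cover u = 0 -> bounds (tens u y).
Proof.
move=> u0; have uP : u \in ker (@free_cover R (syzygy T)) by apply/eqP.
pose w : {freeg (syzygy (syzygy T)) / R} := << Submod uP : syzygy (syzygy T) >>.
exists (tens w y); rewrite tensor_map_tens; congr tens.
exact: free_diffU.
Qed.

Let bounds_sum n (F : 'I_n -> tensor {freeg (syzygy T) / R} M) :
  (forall i, bounds (F i)) -> bounds (\sum_i F i).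
Proof.
move=> FP; elim/big_ind: _ => //.
by exists 0; rewrite linear0.
Qed.

(* Induction on the generators t involved.  The coefficients of t in the k_i,
   together with a non-nilpotent s killing t, form a nonnil column; the
   criterion replaces the k_i by combinations in which t no longer occurs. *)
Lemma bounds_of_coeff (Mflat : nonnil_flat M) (Ttors : phi_torsion T)
    (ts : seq T) n (k : 'I_n -> syzygy T) (m : 'I_n -> M) :
    (forall i t, t \notin ts -> coeff t (val (k i)) = 0) ->
    (forall t, \sum_i coeff t (val (k i)) *: m i = 0) ->
  bounds (\sum_i tens (<< k i >> : {freeg (syzygy T) / R}) (m i)).
Proof.
elim: ts n k m => [|t ts IH] n k m supp km.
  (* With no generator left, every [k i] is zero as a syzygy, so the basis element << k i >> is a
     cycle. *)
  apply: bounds_sum => i; apply: bounds_cycle.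
  rewrite /free_cover liftU scale1r; apply/val_inj/eqP/freeg_eqP => t.
  by rewrite supp // coeff0.
have [J [s sJ snil] st] := Ttors t.
(* The extra syzygy s <<t>> puts s into the column [a]. Its partner in [m'] is 0, so the sums are
   unchanged. *)
have stP : s *: << t >> \in ker (@free_cover R T).
  by rewrite inE /= linearZ_LR /= /free_cover liftU scale1r st.
pose k' (i : 'I_(1 + n)) : syzygy T :=
  if split i is inr j then k j else Submod stP.
pose m' (i : 'I_(1 + n)) : M := if split i is inr j then m j else 0.
pose a : 'cV_(1 + n) := \col_i coeff t (val (k' i)).
have a_nonnil : nonnil_column a.
  exists (delta_mx 0 (lshift n 0)); rewrite -rowE mxE mxE /k'.
  by rewrite (unsplitK (inl _ 0)) /= coeffZ coeffU eqxx !mulr1.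
have km' u : \sum_i coeff u (val (k' i)) *: m' i = 0.
  rewrite big_split_ord big_ord1 /m' /k' (unsplitK (inl _ 0)) /= scaler0 add0r.
  rewrite -[RHS](km u); apply: eq_bigr => i _.
  by rewrite (unsplitK (inr _ i)).
have [|q [B [y [Ba m'E]]]] := Mflat _ a m' a_nonnil.
  by rewrite -[RHS](km' t); apply: eq_bigr => i _; rewrite mxE.
(* Since B a = 0, the generator t cancels in every [k'' j]. *)
pose k'' j : syzygy T := \sum_i B j i *: k' i.
have k''E j u : coeff u (val (k'' j)) = \sum_i B j i * coeff u (val (k' i)).
  by rewrite /k'' !raddf_sum /=; apply: eq_bigr => i _; rewrite coeffZ.
have -> : \sum_i tens (<< k i >> : {freeg (syzygy T) / R}) (m i) =
    \sum_i tens (<< k' i >> : {freeg (syzygy T) / R}) (m' i).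
  rewrite big_split_ord big_ord1 /m' /k' (unsplitK (inl _ 0)) /= tens0r add0r.
  by apply: eq_bigr => i _; rewrite (unsplitK (inr _ i)).
(* [w j] and << k'' j >> have the same image under [free_cover], so they differ by a cycle. *)
pose w j : {freeg (syzygy T) / R} := \sum_i B j i *: << k' i >>.
have -> : \sum_i tens (<< k' i >> : {freeg (syzygy T) / R}) (m' i) =
    \sum_j tens (w j - << k'' j >>) (y j) + \sum_j tens << k'' j >> (y j).
  rewrite -big_split /= (eq_bigr (fun j => tens (w j) (y j))); last first.
    by move=> j _; rewrite -tensDl subrK.
  under eq_bigr do rewrite m'E tens_sumr.
  rewrite exchange_big; apply: eq_bigr => j _; rewrite tens_suml.
  by apply: eq_bigr => i _; rewrite tensZr tensZl.
apply: boundsD.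
  apply: bounds_sum => j; apply: bounds_cycle.
  have wE : free_cover (w j) = k'' j.
    rewrite /w linear_sum; apply: eq_bigr => i _.
    by rewrite linearZ_LR /= free_coverU.
  by rewrite linearB /= wE free_coverU subrr.
apply: IH => [j u|u].
  rewrite k''E; case: (eqVneq u t) => [-> _|ut uts].
    have /matrixP/(_ j 0) := Ba; rewrite !mxE => Baj; rewrite -[RHS]Baj.
    by apply: eq_bigr => i _; rewrite mxE.
  rewrite big1 // => i _; rewrite /k'.
  case: (split i) => [_|l] /=.
    by rewrite coeffZ coeffU eq_sym (negPf ut) !mulr0.
  by rewrite supp ?mulr0 // inE negb_or ut.
rewrite -[RHS](km' u).
under eq_bigr do rewrite k''E scaler_suml.
rewrite exchange_big; apply: eq_bigr => i _ /=.
by rewrite m'E scaler_sumr; apply: eq_bigr => j _; rewrite scalerA mulrC.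
Qed.

End EquationalFlatnessConverse.

Lemma nonnil_flat_phi_flat (R : comNzRingType) (M : lmodType R) :
  nonnil_flat M -> phi_flat M.
Proof.
move=> Mflat T Ttors h; rewrite -[h]quotmod_reprK; apply/eqP.
rewrite quotmod_proj_eq0; apply/asboolP; set z := val (repr h).
have /eqP z0 : tensor_map M (@free_diff R T) z == 0.
  exact: (submod_valP (repr h)).
have [n [k [m zE]]] := tensor_freegP z; rewrite zE in z0 *.
(* The induction starts from the union of the supports of the [k i]. *)
apply: (@bounds_of_coeff R M T Mflat Ttors
  (flatten [seq dom (val (k i)) | i <- enum 'I_n])).
  move=> i t /flatten_mapP tP; apply: coeff_outdom; apply/negP => ti.
  by apply: tP; exists i; rewrite ?mem_enum.
(* The map induced by the coefficient at t turns the cycle equation [z0] into the vanishing sum. *)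
move=> t; have [||f fE] :=
  @tensor_lift R {freeg T / R} M M (fun u y => coeff t u *: y).
- by move=> y r u v; rewrite coeffD coeffZ scalerDl scalerA.
- by move=> u r x y; rewrite scalerDr !scalerA mulrC.
rewrite -[RHS](linear0 f) -z0 !raddf_sum; apply: eq_bigr => i _.
by rewrite /= tensor_map_tens /= free_diffU fE.
Qed.

Lemma phi_flatP (R : comNzRingType) (M : lmodType R) :
  phi_flat M <-> nonnil_flat M.
Proof.
by split; [exact: phi_flat_nonnil_flat | exact: nonnil_flat_phi_flat].
Qed.

(** * Finite presentation of ideals through syzygies of columns *)

Section FinitePresentation.
Variable R : comNzRingType.

Definition finite_syzygies n (a : 'cV[R]_n) :=
  exists k (B : 'M[R]_(k, n)),
    B *m a = 0 /\ forall v : 'rV_n, v *m a = 0 -> exists w : 'rV_k, v = w *m B.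

Lemma mx11_eq0 (A : 'M[R]_1) : A 0 0 = 0 -> A = 0.
Proof. by move=> A0; apply/matrixP => i j; rewrite !ord1 mxE. Qed.

(** Reduces the abstract maps of a presentation to matrix algebra. *)
Lemma linear_rowE n (I : submodClosed R^o) (f : {linear 'rV[R]_n -> submod I}) v :
  val (f v) = (v *m \col_i (val (f (delta_mx 0 i)) : R)) 0 0.
Proof.
rewrite [in LHS](row_sum_delta v) !linear_sum /= mxE; apply: eq_bigr => i _.
rewrite (linearZ_LR f) mxE.
exact: (linearZ_LR (val : {linear submod I -> R^o})).
Qed.

Lemma finitely_generatedP (I : submodClosed R^o) :
  finitely_generated (submod I) <-> exists n (a : 'cV[R]_n), generates a I.
Proof.
split=> [[n [f fsurj]]|[n [a aI]]].
  exists n, (\col_i (val (f (delta_mx 0 i)) : R)) => x; split=> [xI|[c ->]].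
    by have [v fv] := fsurj (Submod xI); exists v; rewrite -linear_rowE fv.
  by rewrite -linear_rowE; exact: submod_valP.
have cI (c : 'rV_n) : ((c *m a) 0 0 : R^o) \in I by apply/aI; exists c.
exists n; have [|f fE] := @exists_linear R 'rV_n (submod I) (fun c => Submod (cI c)).
  by move=> r c d; apply: val_inj; rewrite /= mulmxDl -scalemxAl !mxE.
exists f => x; have /aI[c xE] := submod_valP x.
by exists c; rewrite fE; apply: val_inj.
Qed.

Lemma finite_syzygies_presented n (a : 'cV[R]_n) I :
  generates a I -> finite_syzygies a -> finitely_presented (submod I).
Proof.
move=> aI [k [B [Ba Bv]]].
have cI (c : 'rV_n) : ((c *m a) 0 0 : R^o) \in I by apply/aI; exists c.
have [|f fE] := @exists_linear R 'rV_n (submod I) (fun c => Submod (cI c)).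
  by move=> r c d; apply: val_inj; rewrite /= mulmxDl -scalemxAl !mxE.
exists k, n, (mulmxr B), f; split=> [x|v].
  have /aI[c xE] := submod_valP x.
  by exists c; rewrite fE; apply: val_inj.
rewrite fE; split=> [/(congr1 val)/= /mx11_eq0 /Bv[w ->]|[w /= <-]].
  by exists w.
by apply: val_inj; rewrite /= -mulmxA Ba mulmx0 mxE.
Qed.

(* Schanuel's argument: with a = A b and b = C a, where b generates I subject to
   the relations G, the rows of 1 - A C and of G C generate the syzygies of a. *)
Lemma presented_finite_syzygies n (a : 'cV[R]_n) I :
  generates a I -> finitely_presented (submod I) -> finite_syzygies a.
Proof.
move=> aI [p [q [g [f [fsurj fg]]]]].
pose b : 'cV[R]_q := \col_i (val (f (delta_mx 0 i)) : R).
have [A Ab] : exists A : 'M_(n, q), A *m b = a.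
  have /choice[A AE] i : exists v, val (f v) = a i 0 :> R.
    have aiI : (a i 0 : R^o) \in I.
      by apply/aI; exists (delta_mx 0 i); rewrite -rowE mxE.
    by have [v fv] := fsurj (Submod aiI); exists v; rewrite fv.
  exists (\matrix_i A i); apply/row_matrixP => i; rewrite row_mul rowK.
  by apply/matrixP => j l; rewrite !ord1 -linear_rowE AE mxE.
have [C Ca] : exists C : 'M_(q, n), C *m a = b.
  have /choice[C CE] i : exists c : 'rV_n, b i 0 = (c *m a) 0 0.
    by rewrite mxE; apply/aI; exact: submod_valP.
  exists (\matrix_i C i); apply/row_matrixP => i; rewrite row_mul rowK.
  by apply/matrixP => j l; rewrite !ord1 [RHS]mxE -CE.
have fE v : f v = 0 <-> v *m b = 0.
  split=> [fv|vb]; first by apply: mx11_eq0; rewrite -linear_rowE fv.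
  by apply: val_inj; rewrite linear_rowE -/b vb mxE.
pose G := lin1_mx g.
have Gb : G *m b = 0.
  apply/row_matrixP => i; rewrite row_mul rowE mul_rV_lin1 row0.
  by apply/fE/fg; exists (delta_mx 0 i).
exists (n + p)%N, (col_mx (1%:M - A *m C) (G *m C)); split=> [|v va].
  by rewrite mul_col_mx mulmxBl mul1mx -!mulmxA Ca Ab subrr Gb col_mx0.
have /fE/fg[w gw] : v *m A *m b = 0 by rewrite -mulmxA Ab.
(* v = v (1 - A C) + v A C, and v A = w G because v A kills b. *)
exists (row_mx v w); rewrite mul_row_col mulmxBr mulmx1 !mulmxA.
by rewrite mul_rV_lin1 gw subrK.
Qed.

Lemma nonnil_coherentP :
  nonnil_coherent R <->
  forall n (a : 'cV[R]_n), nonnil_column a -> finite_syzygies a.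
Proof.
split=> [Rcoh n a an|H I Inn /finitely_generatedP[n [a aI]]].
  have [I aI] := generates_exists a.
  apply: (presented_finite_syzygies aI); apply: Rcoh.
    exact/(nonnil_generates aI).
  by apply/finitely_generatedP; exists n, a.
apply: (finite_syzygies_presented aI); apply: H.
exact/(nonnil_generates aI).
Qed.

End FinitePresentation.

(** * Permanence of the equational criterion *)

Section FlatPermanence.
Variable R : comNzRingType.

(** By commutativity the row m is itself a syzygy of [a], so one relation with y = 1 suffices. *)
Lemma nonnil_flat_regular : nonnil_flat (R^o : lmodType R).
Proof.
move=> n a m _ am; exists 1%N, (\row_i (m i : R)), (fun=> 1); split=> [|i].
  apply: mx11_eq0; rewrite mxE -[RHS]am; apply: eq_bigr => i _.
  by rewrite mxE; exact: mulrC.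
by rewrite big_ord1 mxE; exact/esym/mulr1.
Qed.

(** The relation matrix found in M serves in N; only the solution is carried over by [g]. *)
Lemma nonnil_flat_retract (M N : lmodType R) (f : {linear N -> M})
    (g : {linear M -> N}) :
  cancel f g -> nonnil_flat M -> nonnil_flat N.
Proof.
move=> fK Mflat n a m an am.
have [|k [B [y [Ba mE]]]] := Mflat n a (f \o m) an.
  rewrite -[RHS](linear0 f) -am linear_sum; apply: eq_bigr => i _.
  by rewrite linearZ_LR.
exists k, B, (g \o y); split=> // i; rewrite -[LHS]fK [f _]mE linear_sum.
by apply: eq_bigr => j _; rewrite linearZ_LR.
Qed.

Lemma nonnil_flat_prodmod (I : Type) (V : I -> lmodType R) :
    nonnil_coherent R -> (forall i, nonnil_flat (V i)) ->
  nonnil_flat (prodmod V).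
Proof.
move=> /nonnil_coherentP Rcoh Vflat n a m an am.
have [k [B [Ba Bv]]] := Rcoh n a an.
have yP i : exists y : 'I_k -> V i, forall l, m l i = \sum_j B j l *: y j.
  have [|q [C [z [Ca mE]]]] := Vflat i n a (fun l => m l i) an.
    by rewrite -[RHS](congr1 (fun h : prodmod V => h i) am) prodmod_sumE.
  (* The relations C depend on the factor i; writing C = D B moves this dependence into the
     solution. *)
  have /choice[D CE] j : exists w : 'rV_k, row j C = w *m B.
    by apply: Bv; rewrite -row_mul Ca row0.
  exists (fun j => \sum_l D l 0 j *: z l) => l; rewrite mE.
  under [RHS]eq_bigr do rewrite scaler_sumr.
  rewrite exchange_big; apply: eq_bigr => h _ /=.
  have -> : C h l = (row h C) 0 l by rewrite mxE.
  rewrite CE mxE scaler_suml; apply: eq_bigr => j _.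
  by rewrite scalerA mulrC.
exists k, B, (fun j i => sval (cid (yP i)) j); split=> // l.
apply/functional_extensionality_dep => i; rewrite prodmod_sumE.
exact: (svalP (cid (yP i))).
Qed.

End FlatPermanence.

Lemma flat_powers_coherent (R : comNzRingType) :
    (forall K : Type, nonnil_flat (prodmod (fun _ : K => R^o : lmodType R))) ->
  nonnil_coherent R.
Proof.
move=> Rflat; apply/nonnil_coherentP => n a an.
pose K := {v : 'rV[R]_n | v *m a = 0}.
(* The i-th vector maps a syzygy to its i-th entry, so each coordinate of the required equation is a
   syzygy equation. *)
have [|k [B [y [Ba yE]]]] := Rflat K n a (fun i v => sval v 0 i) an.
  apply/functional_extensionality_dep => v; rewrite prodmod_sumE.
  have := congr1 (fun N : 'M_1 => N 0 0) (svalP v); rewrite !mxE => va.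
  by rewrite -[RHS]va; apply: eq_bigr => i _; exact: mulrC.
(* Read at the coordinate v, the criterion expresses v as a combination of the rows of B. *)
exists k, B; split=> // v va; exists (\row_j y j (exist _ v va)).
apply/rowP => i; rewrite mxE.
have := congr1 (fun h : prodmod _ => h (exist _ v va)) (yE i).
rewrite prodmod_sumE /= => ->; apply: eq_bigr => j _.
by rewrite mxE; exact: mulrC.
Qed.

(** * Pure closure of the image of a map *)

Section PureClosure.
Variables (R : comNzRingType) (M : lmodType R).

(* Formal names for the elements of the submodule of any module under [M]
   obtained from the image of [M] by adjoining solutions of solvable finite
   linear systems: they form a small type independent of the target. *)
Inductive pure_term : Type :=
| PureGen of M
| PureAdd of pure_term & pure_term
| PureScale of R & pure_term
| PureSol k n of 'M[R]_(k, n) & ('I_n -> pure_term) & 'I_k.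

HB.instance Definition _ := gen_eqMixin pure_term.
HB.instance Definition _ := gen_choiceMixin pure_term.

Variables (F : lmodType R) (f : {linear M -> F}).

Definition solvable k n (B : 'M[R]_(k, n)) (x : 'I_n -> F) :=
  exists y : 'I_k -> F, forall i, x i = \sum_j B j i *: y j.

(** A fixed choice, so that every term has a value. Unsolvable systems get 0, which is harmless: the
    property is invoked only for solvable ones. *)
Definition solution k n (B : 'M[R]_(k, n)) (x : 'I_n -> F) : 'I_k -> F :=
  if pselect (solvable B x) is left h then sval (cid h) else fun=> 0.

Lemma solutionP k n (B : 'M[R]_(k, n)) (x : 'I_n -> F) :
  solvable B x -> forall i, x i = \sum_j B j i *: solution B x j.
Proof. by rewrite /solution; case: pselect => // h _; exact: svalP (cid h). Qed.

Fixpoint pure_eval t : F :=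
  match t with
  | PureGen m => f m
  | PureAdd s t => pure_eval s + pure_eval t
  | PureScale c t => c *: pure_eval t
  | PureSol k n B m j => solution B (fun i => pure_eval (m i)) j
  end.

Let ev : {linear {freeg pure_term / R} -> F} := fglift pure_eval.

Let evU t : ev << t >> = pure_eval t.
Proof. by rewrite /ev /= liftU scale1r. Qed.

(** Sums and multiples are terms for this purpose: every element of the image has a single name,
    which can then enter a [PureSol]. *)
Let ev_image u : exists t, ev u = pure_eval t.
Proof.
rewrite -[u]freeg_sumE raddf_sum; elim/big_ind: _ => [|_ _ [s ->] [t ->]|t _].
- by exists (PureGen 0); rewrite /= linear0.
- by exists (PureAdd s t).
- by exists (PureScale (coeff t u) t); rewrite /ev /= liftU.
Qed.

(** The quotient by the kernel of [ev] is isomorphic to its image, which is closed under solving the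
    finite systems solvable in [F]; the criterion thus descends from [F]. *)
Lemma pure_factorization : nonnil_flat F ->
  exists (W : submodClosed {freeg pure_term / R}) (g : {linear M -> quotmod W})
    (h : {linear quotmod W -> F}),
    nonnil_flat (quotmod W) /\ forall x, h (g x) = f x.
Proof.
move=> Fflat; pose W : submodClosed {freeg pure_term / R} := ker ev.
pose i (q : quotmod W) := ev (repr q).
have iE u : i (quotmod_proj W u) = ev u.
  apply/eqP; rewrite -subr_eq0 -linearB.
  change (repr (quotmod_proj W u) - u \in W).
  by rewrite -quotmod_proj_eq0 linearB /= quotmod_reprK subrr.
have [|h hE] := @exists_linear R (quotmod W) F i.
  move=> c p q; rewrite -[p]quotmod_reprK -[q]quotmod_reprK.
  by rewrite -linearP !iE linearP.
have {}iE u : h (quotmod_proj W u) = ev u by rewrite hE.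
have h0 q : h q = 0 -> q = 0.
  rewrite -[q]quotmod_reprK iE => q0; apply/eqP; rewrite quotmod_proj_eq0.
  exact/eqP.
have h_inj p q : h p = h q -> p = q.
  move=> pq; apply/eqP; rewrite -subr_eq0; apply/eqP/h0.
  by rewrite linearB /= pq subrr.
have [|g gE] := @exists_linear R M (quotmod W)
    (fun x => quotmod_proj W << PureGen x >>).
  by move=> c x y; apply: h_inj; rewrite linearP /= !iE !evU /= linearP.
exists W, g, h; split=> [|x]; last by rewrite gE iE evU.
move=> n a m an am; have [|k [B [y [Ba mE]]]] := Fflat n a (h \o m) an.
  rewrite -[RHS](linear0 h) -am linear_sum; apply: eq_bigr => l _.
  by rewrite linearZ_LR.
have /choice[t tE] l : exists t, h (m l) = pure_eval t.
  by rewrite -[m l]quotmod_reprK iE; exact: ev_image.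
(* [y] only shows that the system is solvable; it is replaced by the chosen solution, which has a
   name. *)
exists k, B, (fun j => quotmod_proj W << PureSol B t j >>); split=> // l.
apply: h_inj; rewrite linear_sum.
have tB : solvable B (fun l => pure_eval (t l)).
  by exists y => l'; rewrite -tE; exact: mE.
rewrite tE (solutionP tB l); apply: eq_bigr => j _.
by rewrite linearZ_LR /= iE evU.
Qed.

End PureClosure.

(** * The two implications *)

Lemma coherent_preenveloping (R : comNzRingType) :
  nonnil_coherent R -> preenveloping (@phi_flat R).
Proof.
move=> Rcoh M.
(* The index type depends only on [M], so one product serves all targets. *)
pose I := {W : submodClosed {freeg (pure_term M) / R} &
  {g : {linear M -> quotmod W} | nonnil_flat (quotmod W)}}.
pose V (i : I) : lmodType R := quotmod (tag i).
have [|e eE] := @exists_linear R M (prodmod V) (fun x i => sval (tagged i) x).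
  by move=> c x y; apply/functional_extensionality_dep => i; rewrite linearP.
exists (prodmod V), e; split=> [|F f /phi_flatP Fflat].
  apply/phi_flatP/nonnil_flat_prodmod => // i; exact: svalP (tagged i).
have [W [g [h [Wflat hg]]]] := pure_factorization f Fflat.
(* [f] factors through the projection to the factor given by its own pure closure, followed by
   [h]. *)
pose i : I := Tagged _ (exist _ g Wflat).
have [|p pE] := @exists_linear R (prodmod V) F (fun z => h (z i)).
  by move=> c x y; rewrite -linearP.
by exists p => x; rewrite /= pE eE -hg.
Qed.

Lemma preenveloping_coherent (R : comNzRingType) :
  preenveloping (@phi_flat R) -> nonnil_coherent R.
Proof.
move=> Rpre; apply: flat_powers_coherent => K.
set P := prodmod _; have [E [f [/phi_flatP Eflat fP]]] := Rpre P.
(* R is phi-flat, so each coordinate of the power extends along [f]; together the extensions form a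
   retraction. *)
have /(_ _)/cid gP (i : K) :
    exists g : {linear E -> R^o}, forall x : P, g (f x) = x i.
  have [|p pE] := @exists_linear R P R^o (fun x => x i); first by [].
  have [|g gE] := fP R^o p; first exact/phi_flatP/nonnil_flat_regular.
  by exists g => x; rewrite -pE gE.
have [|g gE] := @exists_linear R E P (fun x i => sval (gP i) x).
  by move=> c x y; apply/functional_extensionality_dep => i; rewrite linearP.
apply: (@nonnil_flat_retract R E P f g) => // x.
by rewrite gE; apply/functional_extensionality_dep => i; exact: (svalP (gP i)).
Qed.

Theorem proposition1p9 (R : comNzRingType) (R_phi : phi_ring R) :
  nonnil_coherent R <-> preenveloping (@phi_flat R).
Proof.
by split; [exact: coherent_preenveloping | exact: preenveloping_coherent].
Qed.
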